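(* For every proper planar metric $\rho$ on $\mathbb{R}^2$, $\chi((\mathbb{R}^2,\rho),\{1\})$ is a finite positive integer; i.e. $\mathsf{PLANAR}^*\subset\mathbb{N}$.
   Context: A planar metric is a metric $\rho$ on $\mathbb{R}^2$ that is translation invariant ($\rho(x,y)=\rho(x+v,y+v)$ for all $x,y,v$) and induces the usual topology on $\mathbb{R}^2$. It is proper if its closed balls are compact. $\mathsf{PLANAR}^*$ is the set of all values of $\chi((\mathbb{R}^2,\rho),\{1\})$ over proper planar metrics, where $\chi(X,D)$ is the chromatic number of the graph on $X$ in which $x\sim y$ iff $\rho(x,y)\in D$ (possibly infinite a priori). *)

(* Defs.v *)
From HB Require Import structures.
From mathcomp Require Import all_boot all_order all_algebra.
From mathcomp Require Import all_classical all_reals all_analysis.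

Set Implicit Arguments.
Unset Strict Implicit.
Unset Printing Implicit Defensive.

Import Order.TTheory GRing.Theory Num.Theory.
Import numFieldNormedType.Exports.

Local Open Scope classical_set_scope.
Local Open Scope ring_scope.

(* The library's [metricType] bundles a distance with the topology of its
   carrier.  Here many metrics live on one type which already has a topology,
   so metrics are plain functions. *)
Record is_metric (R : realType) (X : Type) (rho : X -> X -> R) : Prop := {
  metric_ge0 : forall x y, 0 <= rho x y;
  metric_eq0 : forall x y, rho x y = 0 <-> x = y;
  metric_symm : forall x y, rho x y = rho y x;
  metric_trian : forall x y z, rho x z <= rho x y + rho y z }.

Definition metric_open (R : realType) (X : Type) (rho : X -> X -> R)
    (A : set X) : Prop :=
  forall x, A x -> exists2 e : R, 0 < e & [set y | rho x y < e] `<=` A.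

Definition induces_topology (R : realType) (X : topologicalType)
    (rho : X -> X -> R) : Prop :=
  forall A : set X, open A <-> metric_open rho A.

(* [R * R] carries the product topology and the componentwise addition. *)
Record planar_metric (R : realType) (rho : R * R -> R * R -> R) : Prop := {
  planar_is_metric : is_metric rho;
  planar_translation : forall x y v : R * R, rho x y = rho (x + v) (y + v);
  planar_topology : induces_topology rho }.

(* [compact] refers to the given topology of [X]; for a planar metric this is
   also the topology of [rho]. *)
Definition proper_metric (R : realType) (X : topologicalType)
    (rho : X -> X -> R) : Prop :=
  forall (x : X) (r : R), compact [set y | rho x y <= r].

Definition colorable (V : Type) (E : V -> V -> Prop) (k : nat) : Prop :=
  exists c : V -> 'I_k, forall x y, E x y -> c x <> c y.

(* [None] stands for an infinite chromatic number. *)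
Definition chromatic_number (V : Type) (E : V -> V -> Prop) : option nat :=
  if pselect (exists k, `[< colorable E k >]) is left ex_k
  then Some (ex_minn ex_k) else None.

Definition distance_graph (R : realType) (X : Type) (rho : X -> X -> R)
    (D : set R) : X -> X -> Prop := fun x y => D (rho x y).

Definition chi (R : realType) (X : Type) (rho : X -> X -> R) (D : set R) :
    option nat :=
  chromatic_number (distance_graph rho D).

Definition PLANAR_star (R : realType) : set (option nat) :=
  [set k | exists rho : R * R -> R * R -> R,
    [/\ planar_metric rho, proper_metric rho & k = chi rho [set 1]]].

(* Main.v *)
(** By translation invariance, rho(x, y) = N(x - y).  Properness and the equality
    of topologies make the sphere N = 1 bounded and disjoint from a neighbourhood
    of 0, so adjacent points have sup-distance in some [d, M] with d > 0.  Cut the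
    plane into half-open squares of side d and give the square (i, j) the colour
    (i mod K + 1, j mod K + 1) with K d >= M: two points of the same colour are
    either in the same square, at sup-distance < d, or at sup-distance > M. *)
Require Import Defs.
From mathcomp Require Import all_boot all_order all_algebra.
From mathcomp Require Import all_classical all_reals all_analysis.
From mathcomp Require Import zify lra.
Import Order.TTheory GRing.Theory Num.Theory.
Import numFieldNormedType.Exports.
Local Open Scope classical_set_scope.
Local Open Scope ring_scope.

Definition floor_mod (R : realType) (K : nat) (x : R) : 'I_K.+1 :=
  inord `|(Num.floor x %% K.+1%:Z)%Z|%N.

(** Equal residues make the floors differ by [q * (K + 1)]. If [q = 0], both points lie in one
    half-open unit interval; otherwise the fractional parts take less than 1 off a gap of at least
    [K + 1], which is why the modulus is [K + 1]. *)
Lemma floor_mod_eq (R : realType) (K : nat) (x y : R) :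
  floor_mod R K x = floor_mod R K y -> `|x - y| < 1 \/ K%:R < `|x - y|.
Proof.
have mod_ge0 (a : int) : 0 <= (a %% K.+1%:Z)%Z by exact: modz_ge0.
have mod_lt (a : int) : (`|(a %% K.+1%:Z)%Z| < K.+1)%N.
  have := @ltz_mod a K.+1%:Z isT; have := mod_ge0 a; lia.
move=> /(congr1 val); rewrite /floor_mod /= !inordK // => abs_eq.
have /eqP : (Num.floor x = Num.floor y %[mod K.+1%:Z])%Z.
  by have := mod_ge0 (Num.floor x); have := mod_ge0 (Num.floor y); lia.
rewrite eqz_mod_dvd => /dvdzP[q floorB].
have := floor_itv x; have := floor_itv y.
have -> : Num.floor x = Num.floor y + q * K.+1%:Z by lia.
rewrite !intrD intrM mulr1z -pmulrn -natr1.
have [q_lt0|q_gt0|->] := ltgtP q 0.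
- have : q%:~R <= -1 :> R by rewrite -(mulrN1z 1) ler_int; lia.
  have := ler0n R K; move=> K_ge0 qN1 ? ?; right.
  by rewrite distrC; apply: (lt_le_trans _ (ler_norm _)); nra.
- have : 1 <= q%:~R :> R by rewrite (ler_int _ 1); lia.
  have := ler0n R K; move=> K_ge0 qN1 ? ?; right.
  by apply: (lt_le_trans _ (ler_norm _)); nra.
- by rewrite mul0r addr0 => ? ?; left; rewrite ltr_norml; lra.
Qed.

Lemma colorable_of_dist_bounds (R : realType) (E : R * R -> R * R -> Prop)
    (d M : R) : 0 < d ->
  (forall x y, E x y -> d <= `|x - y| <= M) -> exists k, colorable E k.
Proof.
move=> d_gt0 distE; pose K := Num.bound (M / d).
have M_lt : M < K%:R * d by rewrite -ltr_pdivrMr// unstable.ltr_bound.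
pose c (x : R * R) := (floor_mod R K (x.1 / d), floor_mod R K (x.2 / d)).
exists #|{: 'I_K.+1 * 'I_K.+1}|, (fun x => enum_rank (c x)) => x y /distE.
have coord (a b : R) : floor_mod R K (a / d) = floor_mod R K (b / d) ->
    `|a - b| < d \/ M < `|a - b|.
  move=> /floor_mod_eq; rewrite -mulrBl normrM normfV (gtr0_norm d_gt0).
  rewrite ltr_pdivrMr// ltr_pdivlMr// mul1r.
  by case=> [|?]; [left | right; apply: lt_trans M_lt _].
rewrite prod_normE le_max ge_max => /andP[dle /andP[leM1 leM2]].
move=> /enum_rank_inj[/coord c1 /coord c2].
(* Some coordinate differs by at least [d]; sharing a colour, it must then differ by more than [M],
   against [leM1] or [leM2]. *)
move: dle => /= /orP[]; case: c1 => /=; case: c2 => /=; lra.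
Qed.

Section PlanarMetric.
Variables (R : realType) (rho : R * R -> R * R -> R).
Hypothesis rho_planar : planar_metric rho.

Lemma planar_metricB (x y : R * R) : rho x y = rho 0 (x - y).
Proof.
case: rho_planar => -[_ _ sym _] trans _.
by rewrite sym (trans y x (- y)) subrr.
Qed.

Lemma planar_ball_open (r : R) : open [set y | rho 0 y < r].
Proof.
case: rho_planar => -[_ _ _ tri] _ /(_ [set y | rho 0 y < r]) [_ openP].
apply: openP => x /= x_lt; exists (r - rho 0 x); first by rewrite subr_gt0.
by move=> y /= y_lt; apply: le_lt_trans (tri 0 x y) _; lra.
Qed.

(** The open unit [rho]-ball is a neighbourhood of 0 in the product topology, so it contains a
    sup-norm ball, which the unit sphere misses. *)
Lemma unit_sphere_away_from0 :
  exists2 d : R, 0 < d & forall v, rho 0 v = 1 -> d <= `|v|.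
Proof.
case: (rho_planar) => -[_ rho0 _ _] _ _.
have /nbhs_normP[d /= d_gt0 sub] : nbhs (0 : R * R) [set y | rho 0 y < 1].
  apply: open_nbhs_nbhs; split; first exact: planar_ball_open.
  by rewrite /= (rho0 0 0).2.
exists d => // v v1; rewrite leNgt; apply/negP => v_lt.
have := sub v; rewrite /ball_ /= sub0r normrN => /(_ v_lt).
by rewrite v1 ltxx.
Qed.

Lemma unit_sphere_bounded : proper_metric rho ->
  exists M : R, forall v, rho 0 v = 1 -> `|v| <= M.
Proof.
move=> /(_ 0 1) /compact_bounded [M [_ bM]].
(* [compact_bounded] provides only bounds strictly above [M], hence [M + 1]. *)
exists (M + 1) => v v1; apply: (bM (M + 1)); first by rewrite ltrDl.
by rewrite /= v1.
Qed.

Lemma planar_unit_graph_colorable : proper_metric rho ->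
  exists k, colorable (distance_graph rho [set 1]) k.
Proof.
move=> /unit_sphere_bounded[M leM].
have [d d_gt0 dle] := unit_sphere_away_from0.
apply: (colorable_of_dist_bounds R _ d M d_gt0) => x y.
by rewrite /distance_graph /= planar_metricB => xy1; rewrite dle // leM.
Qed.

End PlanarMetric.

(** The vertex [v] has a colour in ['I_n], so the minimal [n] cannot be 0. *)
Lemma chromatic_number_pos (V : Type) (v : V) (E : V -> V -> Prop) :
  (exists k, colorable E k) ->
  exists2 n : nat, (0 < n)%N & chromatic_number E = Some n.
Proof.
move=> [k colk]; rewrite /chromatic_number; case: pselect => [ex_k|[]]; last first.
  by exists k; apply/asboolP.
case: ex_minnP => n /asboolP[c _] _; exists n => //.
exact: leq_ltn_trans (ltn_ord (c v)).
Qed.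

Theorem theorem1p5 (R : realType) :
  (forall rho : R * R -> R * R -> R,
     planar_metric rho -> proper_metric rho ->
     exists2 n : nat, (0 < n)%N & chi rho [set 1] = Some n) /\
  PLANAR_star R `<=` [set Some n | n in [set n : nat | (0 < n)%N]].
Proof.
have chi_pos (rho : R * R -> R * R -> R) : planar_metric rho ->
    proper_metric rho -> exists2 n : nat, (0 < n)%N & chi rho [set 1] = Some n.
  by move=> planar proper;
    apply/(chromatic_number_pos _ (0 : R * R))/planar_unit_graph_colorable.
split=> // _ [rho [planar proper ->]].
by have [n n_gt0 ->] := chi_pos rho planar proper; exists n.
Qed.
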